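(* For every positive integer $n$, every $\frac{1}{13}$-dense partial Latin square of order $n$ containing no more than $5.7\cdot 10^{-7}\cdot n^2$ filled cells in total is completable.
   Context: A Latin square of order $n$ is an $n\times n$ array filled with symbols from $\{1,\dots,n\}$ such that no symbol is repeated in any row or column. A partial Latin square of order $n$ is an $n\times n$ array in which each cell is either blank or contains one symbol from $\{1,\dots,n\}$, such that no symbol is repeated in any row or column. It is completable if its blank cells can be filled so that the resulting array is a Latin square. A partial Latin square of order $n$ is $\epsilon$-dense if each row contains at most $\epsilon n$ filled (nonblank) cells, each column contains at most $\epsilon n$ filled cells, and each symbol occurs in at most $\epsilon n$ cells. *)

(* Defs.v *)
From mathcomp Require Import all_boot all_order all_algebra.

Set Implicit Arguments.
Unset Strict Implicit.
Unset Printing Implicit Defensive.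

Import Order.TTheory GRing.Theory Num.Theory.
Local Open Scope ring_scope.

(* The n symbols are represented by 'I_n, i.e. 0, ..., n - 1 in place of
   1, ..., n; in a partial Latin square a blank cell contains None. *)

Definition latin_square (n : nat) (L : 'M['I_n]_n) : Prop :=
  (forall i, injective (fun j => L i j)) /\
  (forall j, injective (fun i => L i j)).

Definition partial_latin_square (n : nat) (P : 'M[option 'I_n]_n) : Prop :=
  (forall i j1 j2 k, P i j1 = Some k -> P i j2 = Some k -> j1 = j2) /\
  (forall j i1 i2 k, P i1 j = Some k -> P i2 j = Some k -> i1 = i2).

Definition completable (n : nat) (P : 'M[option 'I_n]_n) : Prop :=
  exists2 L : 'M['I_n]_n, latin_square L &
    forall i j k, P i j = Some k -> L i j = k.

Definition filled_cells (n : nat) (P : 'M[option 'I_n]_n) :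
  {set 'I_n * 'I_n} := [set c | P c.1 c.2 != None].

Definition eps_dense (eps : rat) (n : nat) (P : 'M[option 'I_n]_n) : Prop :=
  [/\ forall i, #|[set j | P i j != None]|%:R <= eps * n%:R,
      forall j, #|[set i | P i j != None]|%:R <= eps * n%:R
    & forall k, #|[set c : 'I_n * 'I_n | P c.1 c.2 == Some k]|%:R
                  <= eps * n%:R].

(* Main.v *)
Require Import Defs.
From mathcomp Require Import all_boot all_order all_fingroup all_algebra.
From mathcomp Require Import zify ring lra.

(* Start from a Latin square L that contains almost all of the multiplication
   table of a dihedral group, so that rows of opposite parity form intercalates
   everywhere, and make it agree with P one filled cell at a time by intercalate
   swaps. Exchanging two columns within a row reduces, by one swap, to one
   exchange along a column and one along a symbol, and these can be routed
   through an auxiliary row that is free to choose. Nesting this reduction four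
   times pushes all requirements from the lines prescribed by P onto freely
   chosen lines: on the prescribed lines only cells that already agree with P
   must be avoided, and these are at most n/13 in number. Each filled cell costs
   at most 46 swaps, so few lines ever lose a noticeable part of the dihedral
   structure and suitable auxiliary rows always exist. *)

Set Implicit Arguments.
Unset Strict Implicit.
Unset Printing Implicit Defensive.

(** * Latin squares and intercalate swaps *)

Section Squares.

Variable X : finType.
Implicit Types (x y z r c b e u v w : X) (k m : nat).

Definition ternary := X -> X -> X -> bool.
Implicit Types A G T : ternary.

(** Storing all three lookup functions with their cancellation laws makes rows, columns and symbols
    interchangeable: [turn] only permutes the fields. *)
Record lsq := Lsq {
  symof : X -> X -> X;
  rowof : X -> X -> X;
  colof : X -> X -> X;
  sym_row : forall y z, symof (rowof y z) y = z;
  row_sym : forall x y, rowof y (symof x y) = x;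
  row_col : forall x z, rowof (colof z x) z = x;
  col_row : forall y z, colof z (rowof y z) = y;
  sym_col : forall x z, symof x (colof z x) = z;
  col_sym : forall x y, colof (symof x y) x = y }.

Implicit Types L M : lsq.

(* Cyclic relabelling (row, column, symbol) -> (column, symbol, row); a statement
   about rows, applied to turn L and turn (turn L), is one about columns and
   symbols. *)
Definition turn L : lsq :=
  @Lsq (rowof L) (colof L) (symof L)
    (fun z x => row_col L x z) (fun y z => col_row L y z)
    (fun y x => col_sym L x y) (fun z x => sym_col L x z)
    (fun y x => row_sym L x y) (fun y z => sym_row L y z).

Definition turn3 A : ternary := fun y z x => A x y z.

Lemma symof_injr L x : injective (symof L x).
Proof. by move=> y y' /(congr1 (fun z => colof L z x)); rewrite !col_sym. Qed.

Lemma symof_injl L y : injective (fun x => symof L x y).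
Proof. by move=> x x' /(congr1 (rowof L y)); rewrite !row_sym. Qed.

Lemma rowof_injr L y : injective (rowof L y).
Proof. exact: (@symof_injr (turn L)). Qed.

Lemma rowof_injl L z : injective (fun y => rowof L y z).
Proof. exact: (@symof_injl (turn L)). Qed.

Lemma colof_injr L z : injective (colof L z).
Proof. exact: (@symof_injr (turn (turn L))). Qed.

Lemma colof_injl L x : injective (fun z => colof L z x).
Proof. exact: (@symof_injl (turn (turn L))). Qed.

Lemma lsq_of_inj (s : X -> X -> X) :
  (forall x, injective (s x)) -> (forall y, injective (fun x => s x y)) ->
  exists L, forall x y, symof L x y = s x y.
Proof.
move=> Ir Ic; pose ro y z := invF (Ic y) z; pose co z x := invF (Ir x) z.
have sr y z : s (ro y z) y = z by apply: (f_invF (Ic y)).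
have rs x y : ro y (s x y) = x by apply: (invF_f (Ic y)).
have sc x z : s x (co z x) = z by apply: (f_invF (Ir x)).
have cs x y : co (s x y) x = y by apply: (invF_f (Ir x)).
have rc x z : ro (co z x) z = x by rewrite -{2}(sc x z) rs.
have cr y z : co z (ro y z) = y by rewrite -{1}(sr y z) cs.
by exists (Lsq sr rs rc cr sc cs).
Qed.

(* The bounds that k intercalate swaps guarantee. *)
Definition near_rows k L M :=
  (forall x, #|[set y | symof L x y != symof M x y]| <= 2 * k) /\
  #|[set p | symof L p.1 p.2 != symof M p.1 p.2]| <= 4 * k.

Definition near k L M :=
  [/\ near_rows k L M, near_rows k (turn L) (turn M)
    & near_rows k (turn (turn L)) (turn (turn M))].

Lemma near_turn k L M : near k L M <-> near k (turn L) (turn M).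
Proof. by split=> -[]. Qed.

Lemma near_refl L : near 0 L L.
Proof.
suff H M : near_rows 0 M M by split; apply: H.
split=> [x|]; rewrite leqn0 cards_eq0; apply/eqP/setP=> i;
  by rewrite !inE eqxx.
Qed.

Lemma near_trans k1 k2 L1 L2 L3 :
  near k1 L1 L2 -> near k2 L2 L3 -> near (k1 + k2) L1 L3.
Proof.
have H M1 M2 M3 : near_rows k1 M1 M2 -> near_rows k2 M2 M3 ->
    near_rows (k1 + k2) M1 M3.
  move=> [a b] [a' b']; split=> [x|].
    rewrite mulnDr; apply: leq_trans (leq_add (a x) (a' x)).
    apply: leq_trans (leq_card_setU _ _); apply/subset_leq_card/subsetP=> y.
    rewrite !inE; apply: contraR; rewrite negb_or !negbK.
    by case/andP=> /eqP-> /eqP->.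
  rewrite mulnDr; apply: leq_trans (leq_add b b').
  apply: leq_trans (leq_card_setU _ _); apply/subset_leq_card/subsetP=> y.
  rewrite !inE; apply: contraR; rewrite negb_or !negbK.
  by case/andP=> /eqP-> /eqP->.
by move=> [? ? ?] [? ? ?]; split; apply: H; eauto.
Qed.

Lemma near_mono k1 k2 L M : k1 <= k2 -> near k1 L M -> near k2 L M.
Proof.
move=> le12 [H1 H2 H3].
have H L' M' : near_rows k1 L' M' -> near_rows k2 L' M'.
  by move=> [a b]; split=> [x|]; [move: (a x)|move: b]; lia.
by split; apply: H.
Qed.

(* The swap is defined by exchanging columns y, y' within the rows x, x'; on an
   intercalate this is the same as exchanging rows within columns or symbols
   within cells, which gives the other two lookup functions. *)
Lemma swap L x x' y y' :
  x != x' -> y != y' -> symof L x y = symof L x' y' -> symof L x y' = symof L x' y ->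
  exists M, [/\ near 1 L M, symof M x y = symof L x y', symof M x y' = symof L x y,
    symof M x' y = symof L x' y' & symof M x' y' = symof L x' y] /\
    (forall u v, ~~ ((u \in [:: x; x']) && (v \in [:: y; y'])) ->
       symof M u v = symof L u v).
Proof.
move=> nx ny e1 e2.
pose s u v := if u \in [:: x; x'] then symof L u (tperm y y' v) else symof L u v.
have sE u v : s u v = if v \in [:: y; y'] then symof L (tperm x x' u) v
    else symof L u v.
  rewrite /s !inE; case: (tpermP y y' v) => [->|->|/eqP n1 /eqP n2];
    case: (tpermP x x' u) => [->|->|/eqP m1 /eqP m2];
    rewrite ?eqxx ?orbT ?(negbTE n1) ?(negbTE n2) ?(negbTE m1) ?(negbTE m2) //=;
    by case: ifP.
pose ro v w := if v \in [:: y; y'] then tperm x x' (rowof L v w) else rowof L v w.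
pose co w u := if u \in [:: x; x'] then tperm y y' (colof L w u) else colof L w u.
have sr v w : s (ro v w) v = w.
  by rewrite sE /ro; case: (boolP (_ \in _)) => H; rewrite ?tpermK sym_row.
have rs u v : ro v (s u v) = u.
  by rewrite sE /ro; case: (boolP (_ \in _)) => H; rewrite row_sym ?tpermK.
have sc u w : s u (co w u) = w.
  by rewrite /s /co; case: (boolP (_ \in _)) => H; rewrite ?tpermK sym_col.
have cs u v : co (s u v) u = v.
  by rewrite /s /co; case: (boolP (_ \in _)) => H; rewrite col_sym ?tpermK.
have rc u w : ro (co w u) w = u by rewrite -{2}(sc u w) rs.
have cr v w : co w (ro v w) = v by rewrite -{1}(sr v w) cs.
exists (Lsq sr rs rc cr sc cs).
have s0 u v : ~~ ((u \in [:: x; x']) && (v \in [:: y; y'])) -> s u v = symof L u v.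
  rewrite /s negb_and => /orP[/negbTE->//|].
  rewrite !inE negb_or => /andP[n1 n2]; case: ifP => // _.
  by rewrite tpermD // eq_sym.
have cnt (p1 p2 q1 order_Z : X) (F1 F2 : X -> X -> X) :
    (forall u v, F1 u v != F2 u v -> (u \in [:: p1; p2]) && (v \in [:: q1; order_Z])) ->
    (forall u, #|[set v | F1 u v != F2 u v]| <= 2 * 1) /\
    #|[set p | F1 p.1 p.2 != F2 p.1 p.2]| <= 4 * 1.
  move=> HF; split=> [u|].
    apply: leq_trans (card_size [:: q1; order_Z]).
    by apply/subset_leq_card/subsetP=> v; rewrite inE => /HF/andP[].
  apply: leq_trans (card_size [seq (a, d) | a <- [:: p1; p2], d <- [:: q1; order_Z]]).
  apply/subset_leq_card/subsetP=> -[u v]; rewrite inE /= => /HF.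
  by rewrite !inE !xpair_eqE; do 4!case: eqP.
split; last exact: s0.
split; last 4 first.
- by rewrite /= /s !inE eqxx tpermL.
- by rewrite /= /s !inE eqxx tpermR.
- by rewrite /= /s !inE eqxx orbT tpermL.
- by rewrite /= /s !inE eqxx orbT tpermR.
split; rewrite /near_rows /=.
- apply: (cnt x x' y y') => u v; apply: contraR => /s0 ->; exact/eqP.
- apply: (cnt y y' (symof L x y) (symof L x y')) => v w; rewrite /ro.
  case: ifP => [Hv|_]; last by rewrite eqxx.
  case: tpermP => [E|E|_ _]; last by rewrite eqxx.
    move=> _ /=; rewrite !inE -[w](sym_row L v) E.
    by move: Hv; rewrite !inE => /orP[] /eqP->; rewrite eqxx ?orbT.
  move=> _ /=; rewrite !inE -[w](sym_row L v) E.
  by move: Hv; rewrite !inE => /orP[] /eqP->; rewrite e1 e2 eqxx ?orbT.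
- apply: (cnt (symof L x y) (symof L x y') x x') => w u; rewrite /co.
  case: ifP => [Hu|_]; last by rewrite eqxx.
  rewrite andbT.
  case: tpermP => [E|E|_ _]; last by rewrite eqxx.
    move=> _ /=; rewrite !inE -[w](sym_col L u) E.
    by move: Hu; rewrite !inE => /orP[] /eqP->; rewrite ?e2 eqxx ?orbT.
  move=> _ /=; rewrite !inE -[w](sym_col L u) E.
  by move: Hu; rewrite !inE => /orP[] /eqP->; rewrite ?e1 eqxx ?orbT.
Qed.

End Squares.

(** * Exchanging two entries of a row *)

Section Exchange.

Variable X : finType.
Implicit Types (x y z r c b u v w : X) (k m : nat).
Implicit Types (A G T : ternary X) (L M : lsq X) (F : seq (X * X * X)).

(** Only the entries of [T] that [L] already contains are kept; those still missing from [L] impose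
    nothing. *)
Definition pres T L M :=
  forall x y, T x y (symof L x y) -> symof M x y = symof L x y.

(* Meant for symof L r c = b and symof L r c' = b'. *)
Definition exch T L k r c b c' b' :=
  exists M, [/\ near k L M, pres T L M, symof M r c = b' & symof M r c' = b].

(** [F] holds the few entries, possibly in conflict with [T], on which later steps of the same
    exchange rely. *)
Definition protect T F : ternary X :=
  fun x y z => T x y z || ((x, y, z) \in F).

Lemma pres_turn T L M : pres T L M <-> pres (turn3 T) (turn L) (turn M).
Proof.
split=> H.
  move=> y z; rewrite /turn3 /= => Ht; have := H (rowof L y z) y.
  by rewrite sym_row => /(_ Ht) {1}<-; rewrite row_sym.
move=> x y Ht; have := H y (symof L x y).
by rewrite /turn3 /= row_sym => /(_ Ht) {1}<-; rewrite sym_row.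
Qed.

Lemma pres_protect T F L M : pres (protect T F) L M -> pres T L M.
Proof. by move=> H x y Ht; apply: H; rewrite /protect Ht. Qed.

Lemma pres_mem T F L M x y z :
  pres (protect T F) L M -> symof L x y = z -> (x, y, z) \in F -> symof M x y = z.
Proof. by move=> H <- Hz; apply: H; rewrite /protect Hz orbT. Qed.

Lemma pres_trans T L1 L2 L3 : pres T L1 L2 -> pres T L2 L3 -> pres T L1 L3.
Proof.
by move=> H1 H2 x y Ht; have E := H1 _ _ Ht; rewrite H2 E.
Qed.

Lemma exch_mono T L k1 k2 r c b c' b' :
  k1 <= k2 -> exch T L k1 r c b c' b' -> exch T L k2 r c b c' b'.
Proof. by move=> le12 [M [/(near_mono le12) nM *]]; exists M. Qed.

(** Two further turns bring the result back, since three turns restore all lookup functions. *)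
Lemma exch_col T L k y z1 x1 z2 x2 :
  exch (turn3 T) (turn L) k y z1 x1 z2 x2 ->
  exists M, [/\ near k L M, pres T L M, symof M x2 y = z1 & symof M x1 y = z2].
Proof.
move=> [M [nM pM /= e1 e2]]; exists (turn (turn M)); split.
- exact/near_turn.
- exact/pres_turn.
- by rewrite -e1 /= col_sym.
- by rewrite -e2 /= col_sym.
Qed.

Lemma exch_sym T L k z x1 y1 x2 y2 :
  exch (turn3 (turn3 T)) (turn (turn L)) k z x1 y1 x2 y2 ->
  exists M, [/\ near k L M, pres T L M, symof M x1 y2 = z & symof M x2 y1 = z].
Proof.
move=> /exch_col[M [nM pM e1 e2]]; exists (turn (turn M)); split.
- exact/near_turn.
- exact/pres_turn.
- by rewrite -e1 /= col_sym.
- by rewrite -e2 /= col_sym.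
Qed.

Lemma exch_direct T L r c b c' b' r1 :
  symof L r c = b -> symof L r c' = b' -> symof L r1 c = b' -> symof L r1 c' = b ->
  c != c' -> ~~ T r c b -> ~~ T r c' b' -> ~~ T r1 c b' -> ~~ T r1 c' b ->
  exch T L 1 r c b c' b'.
Proof.
move=> e1 e2 e3 e4 ncc t1 t2 t3 t4.
have nr : r != r1.
  by apply: contraNneq ncc => er; apply/eqP/(@symof_injr _ L r); rewrite e1 er e4.
have [||M [[nM m1 m2 m3 m4] o]] := @swap _ L r r1 c c' nr ncc; try congruence.
exists M; split=> //; try congruence.
move=> x y Ht; apply: o; apply: contraL Ht; rewrite !inE.
by case/andP=> /orP[] /eqP-> /orP[] /eqP->; rewrite ?e1 ?e2 ?e3 ?e4.
Qed.

(* To exchange columns c, c' in rowof r, first bring b' to (u, c) and b to (u, c')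
   for an auxiliary rowof u; then rows r, u and columns c, c' form an
   intercalate. Both preparatory steps are exchanges again, one along column c
   and one along symbol b. *)
Lemma exch_comb T L k1 k2 r c b c' b' r1 r2 u :
  symof L r c = b -> symof L r c' = b' -> symof L r1 c = b' -> symof L r2 c' = b ->
  c != c' -> r1 != r2 -> u \notin [:: r; r1; r2] ->
  ~~ T r c b -> ~~ T r c' b' ->
  let g := symof L u c in let c2 := colof L b u in
  let x := symof L u c' in let y := symof L r2 c2 in
  let d := colof L g r1 in let d' := colof L b' u in
  (forall F, size F <= 6 -> b' != g ->
     (r1, c, b') \notin F -> (u, c, g) \notin F ->
     (r1, d, g) \notin F -> (u, d', b') \notin F ->
     exch (turn3 (protect T F)) (turn L) k1 c b' r1 g u) ->
  (forall F M, size F <= 3 -> near k1 L M -> r2 != u ->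
     symof M u c2 = b -> symof M r2 c' = b -> symof M u c' = x -> symof M r2 c2 = y ->
     (u, c2, b) \notin F -> (r2, c', b) \notin F ->
     (u, c', x) \notin F -> (r2, c2, y) \notin F ->
     exch (turn3 (turn3 (protect T F))) (turn (turn M)) k2 b r2 c' u c2) ->
  exch T L (k1 + k2 + 1) r c b c' b'.
Proof.
move=> e1 e2 e3 e4 ncc n12; rewrite !inE !negb_or => /and3P[nur nu1 nu2] t1 t2.
move=> g c2 x y d d' H1 H2.
have nbb : b != b'.
  by apply: contraNneq ncc => eb; apply/eqP/(@symof_injr _ L r); congruence.
have nr1 : r1 != r by apply: contraNneq nbb => er; rewrite -e1 -er e3.
have nr2 : r2 != r by apply: contraNneq nbb => er; rewrite -e4 er e2.
have ngb : g != b.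
  by apply: contraNneq nur => eg; apply/eqP/(@symof_injl _ L c); exact: etrans eg (esym e1).
have ngb' : g != b'.
  by apply: contraNneq nu1 => eg; apply/eqP/(@symof_injl _ L c); exact: etrans eg (esym e3).
have nxb : x != b.
  by apply: contraNneq nu2 => eg; apply/eqP/(@symof_injl _ L c'); exact: etrans eg (esym e4).
have nxb' : x != b'.
  by apply: contraNneq nur => eg; apply/eqP/(@symof_injl _ L c'); exact: etrans eg (esym e2).
have ec2 : symof L u c2 = b by rewrite /c2 sym_col.
(* The first two entries must survive for the final swap, the other four for the exchange along
   [b]. *)
pose F1 := [:: (r, c, b); (r, c', b'); (u, c2, b); (r2, c', b); (u, c', x);
  (r2, c2, y)].
have N (p q : X) : p != q -> ((p == q) = false) * ((q == p) = false).
  by move=> npq; rewrite (eq_sym q p) (negbTE npq).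
have NN := (N _ _ ncc, N _ _ n12, N _ _ nur, N _ _ nu1, N _ _ nu2, N _ _ nbb,
  N _ _ nr1, N _ _ nr2, N _ _ ngb, N _ _ ngb', N _ _ nxb, N _ _ nxb').
have [||||||M1 [n1 p1 a1 a2]] := exch_col (H1 F1 _ _ _ _ _ _);
  do ?[by rewrite // ?inE ?xpair_eqE !NN ?andbF].
have q1 : pres T L M1 by apply: pres_protect p1.
have [f1 f2 f3] : [/\ symof M1 r c = b, symof M1 r c' = b' & symof M1 u c2 = b].
  by split; apply: (pres_mem p1) => //; rewrite !inE eqxx ?orbT.
have [f4 f5 f6] : [/\ symof M1 r2 c' = b, symof M1 u c' = x & symof M1 r2 c2 = y].
  by split; apply: (pres_mem p1) => //; rewrite !inE eqxx ?orbT.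
pose F2 := [:: (r, c, b); (r, c', b'); (u, c, b')].
have [|||||M2 [n2 p2 b1 b2]] := exch_sym (H2 F2 M1 isT n1 _ f3 f4 f5 f6 _ _ _ _);
  do ?[by rewrite // ?inE ?xpair_eqE !NN ?andbF].
have order_Z : pres T M1 M2 by apply: pres_protect p2.
have [h1 h2 h3] : [/\ symof M2 r c = b, symof M2 r c' = b' & symof M2 u c = b'].
  by split; apply: (pres_mem p2) => //; rewrite !inE eqxx ?orbT.
have nru : r != u by rewrite eq_sym.
have [||M [[nM m1 m2 m3 m4] o]] := @swap _ M2 r u c c' nru ncc; try congruence.
exists M; split; try congruence; first exact: near_trans (near_trans n1 n2) nM.
move=> v w Ht; have E1 := q1 _ _ Ht; have E2 : symof M2 v w = symof L v w.
  by rewrite order_Z E1.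
(* The final swap touches four cells. Those in row [r] held no entry of [T]; those in row [u] were
   changed by a preparatory exchange, which preserves [T], so they held none either. *)
rewrite o //; apply: contraL Ht; rewrite !inE.
case/andP=> /orP[] /eqP ev /orP[] /eqP ew; move: E1 E2; rewrite ev ew ?e1 ?e2 //.
- by rewrite a1 => /eqP; rewrite -/g !NN.
- by rewrite b2 => _ /eqP; rewrite -/x !NN.
Qed.

End Exchange.

(** * Lines that keep most of their structure *)

Section Loads.

Variable X : finType.
Implicit Types (x y z r c b u v w : X) (k m : nat).
Implicit Types (A G T : ternary X) (L M : lsq X) (F : seq (X * X * X)).

Definition load L A x := #|[set y | ~~ A x y (symof L x y)]|.
Definition loadc L A y := load (turn L) (turn3 A) y.
Definition loads L A z := load (turn (turn L)) (turn3 (turn3 A)) z.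

Definition usable G T : ternary X := fun x y z => G x y z && ~~ T x y z.

Definition turnF F := [seq (t.1.2, t.2, t.1.1) | t <- F].

(** Only the at most [2 * k] changed cells and the entries listed in [F] can add to the load. *)
Lemma load_near L M A A' F k m x : near_rows k L M ->
  (forall y z, A x y z -> (x, y, z) \notin F -> A' x y z) ->
  load L A x <= m -> load M A' x <= m + 2 * k + size F.
Proof.
move=> [nLM _] HA lm.
have cF : #|[set y | (x, y, symof M x y) \in F]| <= size F.
  have -> : #|[set y | (x, y, symof M x y) \in F]| =
      #|[set (x, y, symof M x y) | y in [set y | (x, y, symof M x y) \in F]]|.
    by rewrite card_imset // => y y' [].
  apply: leq_trans (card_size F); apply/subset_leq_card/subsetP=> t.
  by case/imsetP=> y; rewrite inE => Hy ->.
have -> : m + 2 * k + size F = m + (2 * k + size F) by rewrite addnA.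
apply: leq_trans (leq_add lm (leq_add (nLM x) cF)).
apply: leq_trans (leq_add (leqnn _) (leq_card_setU _ _)).
apply: leq_trans (leq_card_setU _ _).
apply/subset_leq_card/subsetP=> y; rewrite !inE; apply: contraR.
rewrite !negb_or !negbK => /andP[Ha /andP[/eqP E Hf]].
by apply: HA => //; rewrite -E.
Qed.

Lemma usable_protect G T F x y z :
  usable G (protect T F) x y z = usable G T x y z && ((x, y, z) \notin F).
Proof. by rewrite /usable /protect negb_or andbA. Qed.

Section Protect.

Variables (L M : lsq X) (G T : ternary X) (F : seq (X * X * X)).
Variables (k m m' : nat).
Hypotheses (nLM : near k L M) (lem : m + 2 * k + size F <= m').

Lemma load_protect x : load L (usable G T) x <= m ->
  load M (usable G (protect T F)) x <= m'.
Proof.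
move=> lm; apply: leq_trans lem; move: lm; case: nLM => nr _ _; apply: load_near => // y z Ha Hf.
by rewrite usable_protect Ha.
Qed.

Lemma loadc_protect y : loadc L (usable G T) y <= m ->
  loadc M (usable G (protect T F)) y <= m'.
Proof.
move=> lm; apply: leq_trans lem; move: lm; case: nLM => _ nc _; have -> : size F = size (turnF F) by rewrite size_map.
apply: load_near => // z x Ha Hf; rewrite /turn3 usable_protect.
apply/andP; split=> //; apply: contra Hf => Hf.
by apply/mapP; exists (x, y, z).
Qed.

Lemma loads_protect z : loads L (usable G T) z <= m ->
  loads M (usable G (protect T F)) z <= m'.
Proof.
move=> lm; apply: leq_trans lem; move: lm; case: nLM => _ _ ns.
have -> : size F = size (turnF (turnF F)) by rewrite !size_map.
apply: load_near => // x y Ha Hf; rewrite /turn3 usable_protect.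
apply/andP; split=> //; apply: contra Hf => Hf.
apply/mapP; exists (y, z, x) => //.
by apply/mapP; exists (x, y, z).
Qed.

End Protect.

Definition sparse eta L A m :=
  [/\ #|[set x | m < load L A x]| <= eta,
      #|[set y | m < loadc L A y]| <= eta
    & #|[set z | m < loads L A z]| <= eta].

Lemma sparse_turn eta L A m :
  sparse eta L A m -> sparse eta (turn L) (turn3 A) m.
Proof. by case. Qed.

Lemma sparse_protect eta L M G T F k m m' :
  near k L M -> m + 2 * k + size F <= m' ->
  sparse eta L (usable G T) m -> sparse eta M (usable G (protect T F)) m'.
Proof.
move=> nLM lm [s1 s2 s3]; split; [apply: leq_trans s1|apply: leq_trans s2
  |apply: leq_trans s3]; apply/subset_leq_card/subsetP=> x; rewrite !inE;
  rewrite !ltnNge; apply: contra => Hm.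
- exact: (load_protect nLM lm Hm).
- exact: (loadc_protect nLM lm Hm).
- exact: (loads_protect nLM lm Hm).
Qed.

(** Pairs are counted, not cells, because [protect] may put several symbols into one cell. *)
Definition degree T x := #|[set p | T x p.1 p.2]|.

Definition dense tau T :=
  [/\ forall x, degree T x <= tau, forall y, degree (turn3 T) y <= tau
    & forall z, degree (turn3 (turn3 T)) z <= tau].

Lemma dense_turn tau T : dense tau T -> dense tau (turn3 T).
Proof. by case. Qed.

Lemma dense_protect tau tau' T F :
  tau + size F <= tau' -> dense tau T -> dense tau' (protect T F).
Proof.
move=> lt [d1 d2 d3].
have H (T1 T2 : ternary X) (F' : seq (X * X * X)) x : size F' = size F ->
    (forall y z, T2 x y z -> T1 x y z || ((x, y, z) \in F')) ->
    degree T1 x <= tau -> degree T2 x <= tau'.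
  move=> sF HT HT1; apply: leq_trans lt; rewrite -sF.
  have cF : #|[set p | (x, p.1, p.2) \in F']| <= size F'.
    have -> : #|[set p | (x, p.1, p.2) \in F']| =
        #|[set (x, p.1, p.2) | p in [set p | (x, p.1, p.2) \in F']]|.
      by rewrite card_imset // => -[? ?] [? ?] [-> ->].
    apply: leq_trans (card_size F'); apply/subset_leq_card/subsetP=> t.
    by case/imsetP=> p; rewrite inE => Hp ->.
  apply: leq_trans (leq_add HT1 cF).
  apply: leq_trans (leq_card_setU _ _); apply/subset_leq_card/subsetP=> p.
  by rewrite !inE; apply: HT.
split=> x; [apply: (H T _ F)|apply: (H (turn3 T) _ (turnF F))
  |apply: (H (turn3 (turn3 T)) _ (turnF (turnF F)))] => //;
  rewrite ?size_map // => y z /orP[HT|HF]; apply/orP; try by left.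
- by right; apply/mapP; exists (z, x, y).
- by right; apply/mapP; exists (z, x, y) => //; apply/mapP; exists (y, z, x).
Qed.

Lemma load_dense tau L T x : dense tau T -> load L (fun x y z => ~~ T x y z) x <= tau.
Proof.
case=> /(_ x) d1 _ _; apply: leq_trans d1.
rewrite /load /degree.
have -> : #|[set y | ~~ ~~ T x y (symof L x y)]| =
    #|[set (y, symof L x y) | y in [set y | ~~ ~~ T x y (symof L x y)]]|.
  by rewrite card_imset // => y y' [].
apply/subset_leq_card/subsetP=> t /imsetP[y].
by rewrite !inE negbK => Hy ->.
Qed.

Lemma loadc_dense tau L T y :
  dense tau T -> loadc L (fun x y z => ~~ T x y z) y <= tau.
Proof. by move=> /dense_turn d; apply: (@load_dense tau (turn L) (turn3 T)). Qed.

Lemma loads_dense tau L T z :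
  dense tau T -> loads L (fun x y z => ~~ T x y z) z <= tau.
Proof.
move=> /dense_turn /dense_turn d.
exact: (@load_dense tau (turn (turn L)) (turn3 (turn3 T))).
Qed.

Fixpoint rare (s : seq (pred X * nat)) : Prop :=
  if s is (P, n) :: s' then #|[set u | P u]| <= n /\ rare s' else True.

(** The union bound; the list pairs each bad event with a bound on its size. *)
Lemma avoid s : rare s -> sumn (map snd s) < #|X| ->
  exists u, all (fun q => ~~ q.1 u) s.
Proof.
move=> Hs lt.
have : #|[set u | has (fun q : pred X * nat => q.1 u) s]| <= sumn (map snd s).
  elim: s Hs {lt} => [|[P n] s IHs] /=; last first.
    move=> [HP /IHs H]; apply: leq_trans (leq_add HP H).
    apply: leq_trans (leq_card_setU _ _); apply/subset_leq_card/subsetP=> u.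
    by rewrite !inE.
  by rewrite leqn0 cards_eq0 => _; apply/eqP/setP=> u; rewrite !inE.
set S := [set u | _] => /leq_ltn_trans /(_ lt) ltS.
have : 0 < #|~: S| by rewrite cardsCs setCK subn_gt0.
by case/card_gt0P=> u; rewrite !inE -all_predC; exists u.
Qed.

Lemma card_preim_leq (phi : X -> X) (P Q : pred X) n : injective phi ->
  (forall u, P u -> Q (phi u)) -> #|[set v | Q v]| <= n -> #|[set u | P u]| <= n.
Proof.
move=> Iphi HPQ; apply: leq_trans; rewrite -(card_imset _ Iphi).
apply/subset_leq_card/subsetP=> v /imsetP[u]; rewrite !inE => Hu ->.
exact: HPQ.
Qed.

(** Supplies the auxiliary row of [exch_comb]. Every column or symbol that occurs there depends
    injectively on [u], so each requirement excludes no more rows than there are bad lines or bad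
    entries. The six predicates [A1] to [A6] are separate because the nested lemmas ask different
    things of the six entries; [7 * eta] accounts for the seven conditions on lines that vary with
    [u], and [3] for [r], [r1], [r2]. *)
Lemma choose_row L r r1 r2 c c' b b' (B0 NR NC NS : pred X)
    A1 A2 A3 A4 A5 A6 (n0 eta n1 n2 n3 n4 n5 n6 : nat) :
  #|[set u | B0 u]| <= n0 ->
  #|[set u | NR u]| <= eta -> #|[set u | NC u]| <= eta ->
  #|[set u | NS u]| <= eta ->
  loadc L A1 c <= n1 -> load L A2 r1 <= n2 -> loads L A3 b' <= n3 ->
  loads L A4 b <= n4 -> loadc L A5 c' <= n5 -> load L A6 r2 <= n6 ->
  n0 + 3 + (n1 + n2 + n3 + n4 + n5 + n6) + 7 * eta < #|X| ->
  exists u,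
    let g := symof L u c in let c2 := colof L b u in
    let x := symof L u c' in let y := symof L r2 c2 in
    let d := colof L g r1 in let d' := colof L b' u in
    [/\ ~~ B0 u, u \notin [:: r; r1; r2], A1 u c g, A2 r1 d g & A3 u d' b'] /\
    [/\ A4 u c2 b, A5 u c' x & A6 r2 c2 y] /\
    [/\ ~~ NR u, ~~ NS g, ~~ NC d & ~~ NC d'] /\
    [/\ ~~ NC c2, ~~ NS x & ~~ NS y].
Proof.
move=> h0 hR hC hS h1 h2 h3 h4 h5 h6 lt.
have Id : injective (fun u => colof L (symof L u c) r1).
  by move=> u u' /colof_injl /symof_injl.
have Iy : injective (fun u => symof L r2 (colof L b u)).
  by move=> u u' /symof_injr /colof_injr.
pose s : seq (pred X * nat) :=
  [:: (fun u => B0 u, n0); (fun u => u \in [:: r; r1; r2], 3);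
      (fun u => ~~ A1 u c (symof L u c), n1);
      (fun u => ~~ A2 r1 (colof L (symof L u c) r1) (symof L u c), n2);
      (fun u => ~~ A3 u (colof L b' u) b', n3);
      (fun u => ~~ A4 u (colof L b u) b, n4);
      (fun u => ~~ A5 u c' (symof L u c'), n5);
      (fun u => ~~ A6 r2 (colof L b u) (symof L r2 (colof L b u)), n6);
      (fun u => NR u, eta); (fun u => NS (symof L u c), eta);
      (fun u => NC (colof L (symof L u c) r1), eta);
      (fun u => NC (colof L b' u), eta); (fun u => NC (colof L b u), eta);
      (fun u => NS (symof L u c'), eta);
      (fun u => NS (symof L r2 (colof L b u)), eta)].
have [||u] := @avoid s; last 1 first.
- rewrite /= !negbK => /and5P[p1 p2 p3 p4 /and5P[p5 p6 p7 p8 /and5P[p9 p10 p11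
    p12 /and4P[p13 p14 p15 _]]]].
  by exists u; do ![split].
- rewrite /=; do ![split]; rewrite //.
  + by apply: leq_trans (card_size [:: r; r1; r2]);
      apply/subset_leq_card/subsetP=> u; rewrite inE.
  + apply: card_preim_leq (@symof_injl _ L c) _ h1 => u.
    by rewrite /turn3 /= row_sym.
  + by apply: card_preim_leq Id _ h2 => u /=; rewrite sym_col.
  + apply: card_preim_leq (@symof_injl _ L c') _ h5 => u.
    by rewrite /turn3 /= row_sym.
  + by apply: card_preim_leq (@colof_injr _ L b) _ h6 => u.
  + by apply: card_preim_leq (@symof_injl _ L c) _ hS.
  + exact: card_preim_leq Id _ hC.
  + by apply: card_preim_leq (@colof_injr _ L b') _ hC.
  + by apply: card_preim_leq (@colof_injr _ L b) _ hC.
  + by apply: card_preim_leq (@symof_injl _ L c') _ hS.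
  + exact: card_preim_leq Iy _ hS.
- by move: lt; rewrite /=; move: #|X| => N; lia.
Qed.

End Loads.

(** * Four nested exchange lemmas *)

Section Levels.

Variable X : finType.
Implicit Types (x y z r c b u v w : X) (k m : nat).
Implicit Types (A G T : ternary X) (L M : lsq X) (F : seq (X * X * X)).

Variables (p : X -> bool) (eta : nat).
Hypothesis p_class : forall s : bool, 2 * #|[set u | p u == s]| <= #|X| + 3.

(** A quadrangle condition: as in a dihedral table, a row and two columns of opposite parity
    determine an intercalate, provided that the entries involved belong to [G]. *)
Definition closes G := forall r c b c' b' r1 r2,
  G r c b -> G r c' b' -> G r1 c b' -> G r2 c' b -> p c != p c' -> r1 = r2.

Definition structured G :=
  [/\ forall x y z, G x y z -> p x (+) p y (+) p z = false,
      closes G, closes (turn3 G) & closes (turn3 (turn3 G))].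

Lemma structured_turn G : structured G -> structured (turn3 G).
Proof.
case=> par q1 order_Z q3; split=> // y z x /par.
by case: (p x) (p y) (p z) => [] [] [].
Qed.

Lemma usable_col G T F x y z : usable G T x y z -> (x, y, z) \notin F ->
  usable (turn3 G) (turn3 (protect T F)) y z x.
Proof. by move=> Ha Hf; have := usable_protect G T F x y z; rewrite Ha Hf. Qed.

Lemma usable_sym G T F x y z : usable G T x y z -> (x, y, z) \notin F ->
  usable (turn3 (turn3 G)) (turn3 (turn3 (protect T F))) z x y.
Proof. by move=> Ha Hf; have := usable_protect G T F x y z; rewrite Ha Hf. Qed.

Lemma usable_free G T x y z : usable G T x y z -> ~~ T x y z.
Proof. by case/andP. Qed.

(* The exchange lemmas below need less and less of the prescribed lines.
   exch_usable: all four entries involved are usable and their lines are light;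
   exch_light: the two exchanged entries only have to be outside T;
   exch_half_light: moreover c and b may be arbitrarily depleted;
   exch_any: nothing but the four entries being outside T. *)
Lemma exch_usable_opposite G T L r c b c' b' r1 r2 : structured G ->
  symof L r c = b -> symof L r c' = b' ->
  symof L r1 c = b' -> symof L r2 c' = b ->
  usable G T r c b -> usable G T r c' b' ->
  usable G T r1 c b' -> usable G T r2 c' b ->
  p c != p c' -> exch T L 1 r c b c' b'.
Proof.
move=> [_ q _ _] e1 e2 e3 e4 u1 u2 u3 u4 np.
have E : r1 = r2.
  by move: u1 u2 u3 u4 => /andP[g1 _] /andP[g2 _] /andP[g3 _] /andP[g4 _];
    apply: q g1 g2 g3 g4 np.
have ncc : c != c' by apply: contraNneq np => ->.
rewrite -E in e4 u4.
exact: (exch_direct e1 e2 e3 e4 ncc (usable_free u1) (usable_free u2)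
  (usable_free u3) (usable_free u4)).
Qed.

Lemma card_none : #|[set u : X | xpred0 u]| <= 0.
Proof. by rewrite leqn0 cards_eq0; apply/eqP/setP=> u; rewrite !inE. Qed.

Lemma exch_usable G T L m r c b c' b' r1 r2 : structured G -> 12 * m + 9 < #|X| ->
  symof L r c = b -> symof L r c' = b' ->
  symof L r1 c = b' -> symof L r2 c' = b -> c != c' ->
  usable G T r c b -> usable G T r c' b' ->
  usable G T r1 c b' -> usable G T r2 c' b ->
  loadc L (usable G T) c <= m -> loadc L (usable G T) c' <= m ->
  loads L (usable G T) b <= m -> loads L (usable G T) b' <= m ->
  load L (usable G T) r1 <= m -> load L (usable G T) r2 <= m ->
  exch T L 3 r c b c' b'.
Proof.
move=> sG lt e1 e2 e3 e4 ncc u1 u2 u3 u4 l1 l2 l3 l4 l5 l6.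
have [E|n12] := eqVneq r1 r2.
  rewrite -E in e4 u4; apply: (@exch_mono _ _ _ 1) => //.
  exact: (exch_direct e1 e2 e3 e4 ncc (usable_free u1) (usable_free u2)
    (usable_free u3) (usable_free u4)).
(* Only rows [u] of parity opposite to [r1] are wanted: then both nested exchanges are between lines
   of opposite parity and cost one swap each. This loses about half of the rows, whence the factor
   12 in the bound on [#|X|]. *)
have cp : #|[set u | p u == p r1]| <= (#|X| + 3)./2.
  by have := p_class (p r1); move: #|X| #|_| => N N'; lia.
have [|u [[nB nu a1 a2 a3] [[a4 a5 a6] _]]] :=
  @choose_row _ L r r1 r2 c c' b b' _ xpred0 xpred0 xpred0 _ _ _ _ _ _ _ _ _ _
   _ _ _ _ cp card_none card_none card_none l1 l5 l4 l3 l2 l6.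
  by move: lt; move: #|X| => N; lia.
have [par _ _ _] := sG.
have P x y z : usable G T x y z -> p z = p x (+) p y.
  by case/andP=> /par + _; case: (p x) (p y) (p z) => [] [] [].
apply: (@exch_comb _ T L 1 1 r c b c' b' r1 r2 u) => //;
  do ?[exact: usable_free u1 | exact: usable_free u2].
- move=> F _ _ f1 f2 f3 f4.
  apply: (@exch_usable_opposite (turn3 G) _ (turn L) c b' r1 _ u
    (colof L b' u) (colof L (symof L u c) r1)) => /=;
    do ?[exact: usable_col]; rewrite ?row_col ?row_sym //.
  + exact: structured_turn.
  + by rewrite -e3 row_sym.
  + rewrite (P _ _ _ u3) (P _ _ _ a1).
    by apply: contra nB; case: (p u) (p r1) (p c) => [] [] [].
- move=> F M _ nM _ g1 g2 g3 g4 f1 f2 f3 f4.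
  apply: (@exch_usable_opposite (turn3 (turn3 G)) _ (turn (turn M)) b r2 c' u (colof L b u)
    (symof L r2 (colof L b u)) (symof L u c')) => /=;
    do ?[exact: usable_sym].
  + exact/structured_turn/structured_turn.
  + by rewrite -g2 col_sym.
  + by apply: (@symof_injr _ M u); rewrite sym_col g1.
  + by rewrite -g4 col_sym.
  + by rewrite -g3 col_sym.
  (* The parities of the four given entries force [r1] and [r2] to have the same parity. *)
  + have <- : p r1 = p r2; last by rewrite eq_sym.
    move: (P _ _ _ u1) (P _ _ _ u2) (P _ _ _ u3) (P _ _ _ u4).
    by case: (p r) (p r1) (p r2) (p c) (p c') (p b) (p b') =>
      [] [] [] [] [] [] [].
Qed.

Lemma free_protect T F x y z :
  ~~ T x y z -> (x, y, z) \notin F -> ~~ protect T F x y z.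
Proof. by rewrite /protect negb_or => -> ->. Qed.

Lemma exch_light G T L m r c b c' b' r1 r2 : structured G ->
  sparse eta L (usable G T) m ->
  12 * (m + 9) + 9 < #|X| -> 6 * m + 7 * eta + 3 < #|X| ->
  symof L r c = b -> symof L r c' = b' ->
  symof L r1 c = b' -> symof L r2 c' = b -> c != c' ->
  ~~ T r c b -> ~~ T r c' b' -> usable G T r1 c b' -> usable G T r2 c' b ->
  loadc L (usable G T) c <= m -> loadc L (usable G T) c' <= m ->
  loads L (usable G T) b <= m -> loads L (usable G T) b' <= m ->
  load L (usable G T) r1 <= m -> load L (usable G T) r2 <= m ->
  exch T L 7 r c b c' b'.
Proof.
move=> sG [sR sC sS] lt1 lt2 e1 e2 e3 e4 ncc t1 t2 u3 u4 l1 l2 l3 l4 l5 l6.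
have [E|n12] := eqVneq r1 r2.
  rewrite -E in e4 u4; apply: (@exch_mono _ _ _ 1) => //.
  exact: (exch_direct e1 e2 e3 e4 ncc t1 t2 (usable_free u3) (usable_free u4)).
have [|u [[_ nu a1 a2 a3] [[a4 a5 a6] [[]]]]] :=
  @choose_row _ L r r1 r2 c c' b b' _ _ _ _ _ _ _ _ _ _ _ _ _ _ _ _ _ _
   card_none sR sC sS l1 l5 l4 l3 l2 l6.
  by move: lt2; move: #|X| => N; lia.
rewrite -!leqNgt => b1 b2 b3 b4 [b5 b6 b7].
(* The entries from which the nested exchanges start lie outside row [r], so those of row [r] need
   not be usable. Each level doubles the number of swaps and adds one: 1, 3, 7, 15, 31. *)
apply: (@exch_comb _ T L 3 3 r c b c' b' r1 r2 u) => //.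
- move=> F sF nb f1 f2 f3 f4.
  have lm : m + 2 * 0 + size F <= m + 6 by clear -sF; lia.
  have nL := near_refl L.
  apply: (@exch_usable (turn3 G) _ (turn L) (m + 6) c b' r1 _ u
    (colof L b' u) (colof L (symof L u c) r1)).
  + exact: structured_turn.
  + by move: lt1; clear; move: #|X| => N; lia.
  + by rewrite -e3 /= row_sym.
  + by rewrite /= row_sym.
  + by rewrite /= row_col.
  + by rewrite /= row_col.
  + exact: nb.
  + exact: usable_col u3 f1.
  + exact: usable_col a1 f2.
  + exact: usable_col a3 f4.
  + exact: usable_col a2 f3.
  + exact: (loads_protect nL lm l4).
  + exact: (loads_protect nL lm b2).
  + exact: (load_protect nL lm l5).
  + exact: (load_protect nL lm b1).
  + exact: (loadc_protect nL lm b4).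
  + exact: (loadc_protect nL lm b3).
- move=> F M sF nM nu2 g1 g2 g3 g4 f1 f2 f3 f4.
  (* The three swaps made so far change at most six entries of a line, and up to three more are
     protected. *)
  have lm : m + 2 * 3 + size F <= m + 9 by clear -sF; lia.
  apply: (@exch_usable (turn3 (turn3 G)) _ (turn (turn M)) (m + 9) b r2 c' u
    (colof L b u) (symof L r2 (colof L b u)) (symof L u c')).
  + exact/structured_turn/structured_turn.
  + by move: lt1; clear; move: #|X| => N; lia.
  + by rewrite -g2 /= col_sym.
  + by apply: (@symof_injr _ M u); rewrite sym_col g1.
  + by rewrite -g4 /= col_sym.
  + by rewrite -g3 /= col_sym.
  + exact: nu2.
  + exact: usable_sym u4 f2.
  + exact: usable_sym a4 f1.
  + exact: usable_sym a6 f4.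
  + exact: usable_sym a5 f3.
  + exact: (load_protect nM lm l6).
  + exact: (load_protect nM lm b1).
  + exact: (loadc_protect nM lm l2).
  + exact: (loadc_protect nM lm b5).
  + exact: (loads_protect nM lm b7).
  + exact: (loads_protect nM lm b6).
Qed.

Lemma exch_half_light G T L m tau r c b c' b' r1 r2 : structured G ->
  sparse eta L (usable G T) m -> dense tau T ->
  12 * (m + 26) + 9 < #|X| -> 6 * (m + 17) + 7 * eta + 3 < #|X| ->
  2 * tau + 4 * m + 7 * eta + 3 < #|X| ->
  symof L r c = b -> symof L r c' = b' ->
  symof L r1 c = b' -> symof L r2 c' = b -> c != c' ->
  ~~ T r c b -> ~~ T r c' b' -> ~~ T r1 c b' -> ~~ T r2 c' b ->
  loadc L (usable G T) c' <= m -> loads L (usable G T) b' <= m ->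
  load L (usable G T) r1 <= m -> load L (usable G T) r2 <= m ->
  exch T L 15 r c b c' b'.
Proof.
move=> sG sp dT lt1 lt2 lt3 e1 e2 e3 e4 ncc t1 t2 t3 t4 l2 l4 l5 l6.
have [E|n12] := eqVneq r1 r2.
  rewrite -E in e4 t4; apply: (@exch_mono _ _ _ 1) => //.
  exact: (exch_direct e1 e2 e3 e4 ncc t1 t2 t3 t4).
have [sR sC sS] := sp.
have [|u [[_ nu a1 a2 a3] [[a4 a5 a6] [[]]]]] :=
  @choose_row _ L r r1 r2 c c' b b' _ _ _ _ _ _ _ _ _ _ _ _ _ _ _ _ _ _
   card_none sR sC sS (loadc_dense L c dT) l5 l4 (loads_dense L b dT) l2 l6.
  by move: lt3; clear; move: #|X| => N; lia.
rewrite -!leqNgt => b1 b2 b3 b4 [b5 b6 b7].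
(* Column [c] and symbol [b] take the place of the row in the nested exchanges, the one line whose
   load [exch_light] leaves free. *)
apply: (@exch_comb _ T L 7 7 r c b c' b' r1 r2 u) => //.
- move=> F sF nb f1 f2 f3 f4.
  have lm : m + 2 * 0 + size F <= m + 6 by clear -sF; lia.
  have nL := near_refl L.
  apply: (@exch_light (turn3 G) _ (turn L) (m + 6) c b' r1 _ u
    (colof L b' u) (colof L (symof L u c) r1)).
  + exact: structured_turn.
  + exact/sparse_turn/(sparse_protect nL lm).
  + by move: lt1; clear; move: #|X| => N; lia.
  + by move: lt2; clear; move: #|X| => N; lia.
  + by rewrite -e3 /= row_sym.
  + by rewrite /= row_sym.
  + by rewrite /= row_col.
  + by rewrite /= row_col.
  + exact: nb.
  + exact: free_protect t3 f1.
  + exact: free_protect a1 f2.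
  + exact: usable_col a3 f4.
  + exact: usable_col a2 f3.
  + exact: (loads_protect nL lm l4).
  + exact: (loads_protect nL lm b2).
  + exact: (load_protect nL lm l5).
  + exact: (load_protect nL lm b1).
  + exact: (loadc_protect nL lm b4).
  + exact: (loadc_protect nL lm b3).
- move=> F M sF nM nu2 g1 g2 g3 g4 f1 f2 f3 f4.
  have lm : m + 2 * 7 + size F <= m + 17 by clear -sF; lia.
  apply: (@exch_light (turn3 (turn3 G)) _ (turn (turn M)) (m + 17) b r2 c' u
    (colof L b u) (symof L r2 (colof L b u)) (symof L u c')).
  + exact/structured_turn/structured_turn.
  + exact/sparse_turn/sparse_turn/(sparse_protect nM lm).
  + by move: lt1; clear; move: #|X| => N; lia.
  + by move: lt2; clear; move: #|X| => N; lia.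
  + by rewrite -g2 /= col_sym.
  + by apply: (@symof_injr _ M u); rewrite sym_col g1.
  + by rewrite -g4 /= col_sym.
  + by rewrite -g3 /= col_sym.
  + exact: nu2.
  + exact: free_protect t4 f2.
  + exact: free_protect a4 f1.
  + exact: usable_sym a6 f4.
  + exact: usable_sym a5 f3.
  + exact: (load_protect nM lm l6).
  + exact: (load_protect nM lm b1).
  + exact: (loadc_protect nM lm l2).
  + exact: (loadc_protect nM lm b5).
  + exact: (loads_protect nM lm b7).
  + exact: (loads_protect nM lm b6).
Qed.

Lemma exch_any G T L m tau r c b c' b' r1 r2 : structured G ->
  sparse eta L (usable G T) m -> dense tau T ->
  12 * (m + 59) + 9 < #|X| -> 6 * (m + 50) + 7 * eta + 3 < #|X| ->
  2 * (tau + 6) + 4 * (m + 33) + 7 * eta + 3 < #|X| ->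
  6 * tau + 7 * eta + 3 < #|X| ->
  symof L r c = b -> symof L r c' = b' ->
  symof L r1 c = b' -> symof L r2 c' = b -> c != c' ->
  ~~ T r c b -> ~~ T r c' b' -> ~~ T r1 c b' -> ~~ T r2 c' b ->
  exch T L 31 r c b c' b'.
Proof.
move=> sG sp dT lt1 lt2 lt3 lt4 e1 e2 e3 e4 ncc t1 t2 t3 t4.
have [E|n12] := eqVneq r1 r2.
  rewrite -E in e4 t4; apply: (@exch_mono _ _ _ 1) => //.
  exact: (exch_direct e1 e2 e3 e4 ncc t1 t2 t3 t4).
have [sR sC sS] := sp.
have [|u [[_ nu a1 a2 a3] [[a4 a5 a6] [[]]]]] :=
  @choose_row _ L r r1 r2 c c' b b' _ _ _ _ _ _ _ _ _ _ _ _ _ _ _ _ _ _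
   card_none sR sC sS (loadc_dense L c dT) (load_dense L r1 dT)
   (loads_dense L b' dT) (loads_dense L b dT) (loadc_dense L c' dT)
   (load_dense L r2 dT).
  by move: lt4; clear; move: #|X| => N; lia.
rewrite -!leqNgt => b1 b2 b3 b4 [b5 b6 b7].
(* In the notation of [exch_comb], the lines that [exch_half_light] wants light are now [u], [g],
   [d], [d'] and then [u], [c2], [x], [y], all determined by the free choice of [u]. *)
apply: (@exch_comb _ T L 15 15 r c b c' b' r1 r2 u) => //.
- move=> F sF nb f1 f2 f3 f4.
  have lm : m + 2 * 0 + size F <= m + 6 by clear -sF; lia.
  have lt : tau + size F <= tau + 6 by clear -sF; lia.
  have nL := near_refl L.
  apply: (@exch_half_light (turn3 G) _ (turn L) (m + 6) (tau + 6) c b' r1 _ u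
    (colof L b' u) (colof L (symof L u c) r1)).
  + exact: structured_turn.
  + exact/sparse_turn/(sparse_protect nL lm).
  + exact/dense_turn/(dense_protect lt).
  + by move: lt1; clear; move: #|X| => N; lia.
  + by move: lt2; clear; move: #|X| => N; lia.
  + by move: lt3; clear; move: #|X| => N; lia.
  + by rewrite -e3 /= row_sym.
  + by rewrite /= row_sym.
  + by rewrite /= row_col.
  + by rewrite /= row_col.
  + exact: nb.
  + exact: free_protect t3 f1.
  + exact: free_protect a1 f2.
  + exact: free_protect a3 f4.
  + exact: free_protect a2 f3.
  + exact: (loads_protect nL lm b2).
  + exact: (load_protect nL lm b1).
  + exact: (loadc_protect nL lm b4).
  + exact: (loadc_protect nL lm b3).
- move=> F M sF nM nu2 g1 g2 g3 g4 f1 f2 f3 f4.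
  have lm : m + 2 * 15 + size F <= m + 33 by clear -sF; lia.
  have lt : tau + size F <= tau + 6 by clear -sF; lia.
  apply: (@exch_half_light (turn3 (turn3 G)) _ (turn (turn M)) (m + 33) (tau + 6) b r2 c' u
    (colof L b u) (symof L r2 (colof L b u)) (symof L u c')).
  + exact/structured_turn/structured_turn.
  + exact/sparse_turn/sparse_turn/(sparse_protect nM lm).
  + exact/dense_turn/dense_turn/(dense_protect lt).
  + by move: lt1; clear; move: #|X| => N; lia.
  + by move: lt2; clear; move: #|X| => N; lia.
  + by move: lt3; clear; move: #|X| => N; lia.
  + by rewrite -g2 /= col_sym.
  + by apply: (@symof_injr _ M u); rewrite sym_col g1.
  + by rewrite -g4 /= col_sym.
  + by rewrite -g3 /= col_sym.
  + exact: nu2.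
  + exact: free_protect t4 f2.
  + exact: free_protect a4 f1.
  + exact: free_protect a6 f4.
  + exact: free_protect a5 f3.
  + exact: (load_protect nM lm b1).
  + exact: (loadc_protect nM lm b5).
  + exact: (loads_protect nM lm b7).
  + exact: (loads_protect nM lm b6).
Qed.

End Levels.

(** * Inserting prescribed entries *)

Section Insertion.

Variable X : finType.
Implicit Types (x y z r c b u v w : X) (k m : nat).
Implicit Types (A G T : ternary X) (L M : lsq X) (F : seq (X * X * X)).

Variables (p : X -> bool) (eta : nat).
Hypothesis p_class : forall s : bool, 2 * #|[set u | p u == s]| <= #|X| + 3.

Definition partial T :=
  [/\ forall x y z z', T x y z -> T x y z' -> z = z',
      forall x y y' z, T x y z -> T x y' z -> y = y'
    & forall x x' y z, T x y z -> T x' y z -> x = x'].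

(* The row holding symof L r c in the column where row r has b may be blocked by
   T, so b is first moved within row r to a column v where it is not. *)
Lemma insert G T L m tau r c b : structured p G ->
  sparse eta L (usable G T) m -> dense tau T -> partial T -> T r c b ->
  12 * (m + 89) + 9 < #|X| -> 6 * (m + 80) + 7 * eta + 3 < #|X| ->
  2 * (tau + 6) + 4 * (m + 63) + 7 * eta + 3 < #|X| ->
  6 * tau + 7 * eta + 3 < #|X| ->
  exists M, [/\ near 46 L M, pres T L M & symof M r c = b].
Proof.
move=> sG sp dT [pT1 pT2 pT3] Tb lt1 lt2 lt3 lt4.
have [eb|nab] := eqVneq (symof L r c) b.
  by exists L; split=> //; apply: near_mono (near_refl L).
set a := symof L r c in nab *; pose c' := colof L b r.
have ec' : symof L r c' = b by rewrite /c' sym_col.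
have [sR sC sS] := sp.
(* These are the conditions of [exch_half_light] for columns [c'] and [v] of row [r], and one on the
   entry holding [a] in column [v], which the second exchange needs. *)
pose s : seq (pred X * nat) :=
  [:: (fun v => v \in [:: c; c'], 2);
      (fun v => ~~ ~~ T r v (symof L r v), tau);
      (fun v => ~~ ~~ T (rowof L c' (symof L r v)) c' (symof L r v), tau);
      (fun v => ~~ ~~ T (rowof L v b) v b, tau);
      (fun v => ~~ ~~ T (rowof L v a) v a, tau);
      (fun v => m < loadc L (usable G T) v, eta);
      (fun v => m < loads L (usable G T) (symof L r v), eta);
      (fun v => m < load L (usable G T) (rowof L c' (symof L r v)), eta);
      (fun v => m < load L (usable G T) (rowof L v b), eta)].
have [||v] := @avoid _ s.
- rewrite /=; do ![split]; rewrite //.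
  + by apply: leq_trans (card_size [:: c; c']);
      apply/subset_leq_card/subsetP=> u; rewrite inE.
  + exact: (load_dense L r dT).
  + by apply: card_preim_leq (@symof_injr _ L r) _ (loadc_dense L c' dT) => u.
  + apply: card_preim_leq (@rowof_injl _ L b) _ (loads_dense L b dT) => u.
    by rewrite /turn3 /= col_row.
  + apply: card_preim_leq (@rowof_injl _ L a) _ (loads_dense L a dT) => u.
    by rewrite /turn3 /= col_row.
  + by apply: card_preim_leq (@symof_injr _ L r) _ sS => u.
  + apply: (card_preim_leq (phi := fun u => rowof L c' (symof L r u))) _ sR => //.
    by move=> u u' /rowof_injr /symof_injr.
  + by apply: card_preim_leq (@rowof_injl _ L b) _ sR => u.
- by move: lt1 lt3 lt4; rewrite /=; clear; move: #|X| => N; lia.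
rewrite /= !negbK -!leqNgt !inE negb_or.
case/and5P=> /andP[nvc nvc'] t1 t2 t3 /and5P[t4 l1 l2 l3 /andP[l4 _]].
set e := symof L r v in t1 t2 l2 l3; set r1 := rowof L c' e in t2 l3.
set r2 := rowof L v b in t3 l4; set si := rowof L v a in t4.
have esi : symof L si v = a by rewrite sym_row.
pose F := [:: (r, c, a); (si, v, a)].
have lm : m + 2 * 0 + size F <= m + 2 by rewrite muln0 addn0.
have lt : tau + size F <= tau + 2 by [].
have nL := near_refl L.
have ncc : c' != v by rewrite eq_sym.
have nae : e != a.
  by apply: contraNneq nvc => ea; apply/eqP/(@symof_injr _ L r).
have nba : b != a by rewrite eq_sym.
have ncc' : c' != c by apply: contraNneq nab => E; rewrite -ec' E.
have [M1 [n1 p1 a1 a2]] : exch (protect T F) L 15 r c' b v e.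
  apply: (@exch_half_light _ p eta p_class G _ L (m + 2) (tau + 2) r c' b v e r1 r2) => //.
  + exact: (sparse_protect nL lm).
  + exact: (dense_protect lt).
  + by move: lt1; clear; move: #|X| => N; lia.
  + by move: lt2; clear; move: #|X| => N; lia.
  + by move: lt3; clear; move: #|X| => N; lia.
  + by rewrite sym_row.
  + by rewrite sym_row.
  + apply: free_protect; last by rewrite !inE !xpair_eqE (negbTE nba) !andbF.
    by apply: contra ncc' => H; apply/eqP/(pT2 _ _ _ _ H Tb).
  + by apply: free_protect; rewrite // !inE !xpair_eqE (negbTE nae) !andbF.
  + by apply: free_protect; rewrite // !inE !xpair_eqE (negbTE nae) !andbF.
  + by apply: free_protect; rewrite // !inE !xpair_eqE (negbTE nba) !andbF.
  + exact: (loadc_protect nL lm l1).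
  + exact: (loads_protect nL lm l2).
  + exact: (load_protect nL lm l3).
  + exact: (load_protect nL lm l4).
have q1 : pres T L M1 := pres_protect p1.
have f1 : symof M1 r c = a by apply: (pres_mem p1); rewrite ?inE ?eqxx.
have f2 : symof M1 si v = a by apply: (pres_mem p1); rewrite ?inE ?eqxx ?orbT.
have lm' : m + 2 * 15 + size ([::] : seq (X * X * X)) <= m + 30.
  by rewrite addn0.
have lt' : tau + size ([::] : seq (X * X * X)) <= tau by rewrite addn0.
(* Now [a] and [b] trade places between columns [c] and [v]. Three of the four entries are outside
   [T] because they conflict with the prescribed [(r, c, b)], the fourth by the choice of [v]. *)
have [M2 [n2 p2 b1 b2]] : exch (protect T [::]) M1 31 r c a v b.
  apply: (@exch_any _ p eta p_class G _ M1 (m + 30) tau r c a v b (rowof M1 c b) si) => //.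
  + exact: (sparse_protect n1 lm').
  + exact: (dense_protect lt').
  + by move: lt1; clear; move: #|X| => N; lia.
  + by move: lt2; clear; move: #|X| => N; lia.
  + by move: lt3; clear; move: #|X| => N; lia.
  + by rewrite sym_row.
  + by rewrite eq_sym.
  + by apply: free_protect => //; apply: contra nab => H; apply/eqP/(pT1 _ _ _ _ H Tb).
  + by apply: free_protect => //; apply: contra nvc => H; apply/eqP/(pT2 _ _ _ _ H Tb).
  + apply: free_protect => //; apply: contra nab => H.
    by rewrite -f1 -(pT3 _ _ _ _ H Tb) sym_row.
  + exact: free_protect.
exists M2; split=> //; first exact: (near_trans n1 n2).
exact: pres_trans q1 (pres_protect p2).
Qed.

Lemma degreeE T x : degree T x = \sum_y \sum_z T x y z.
Proof.
by rewrite pair_big /= /degree -sum1dep_card big_mkcond.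
Qed.

Lemma sum_degreeE T :
  \sum_x degree T x = #|[set q : X * X * X | T q.1.1 q.1.2 q.2]|.
Proof.
under eq_bigr do rewrite degreeE.
rewrite -sum1dep_card [RHS]big_mkcond /= pair_big /= pair_big /=.
by apply: eq_bigr => -[[x y] z] _ /=; case: (T x y z).
Qed.

Lemma sum_degree_turn T : \sum_x degree (turn3 T) x = \sum_x degree T x.
Proof.
under eq_bigr do rewrite degreeE.
under [RHS]eq_bigr do rewrite degreeE.
rewrite [RHS]exchange_big /=; apply: eq_bigr => y _.
by rewrite [RHS]exchange_big.
Qed.

(** Markov's inequality: a line whose load rises from at most [d] to more than [m] loses at least
    [m.+1 - d] entries, to changed cells or to [T], and at most [4 * k + t] are lost in all. The [w]
    lines that may be heavy from the start are added. *)
Lemma sparse_near G T L M (k w d t m : nat) :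
  near k L M -> sparse w L G d -> \sum_x degree T x <= t ->
  4 * k + t < (m.+1 - d) * (eta.+1 - w) -> sparse eta M (usable G T) m.
Proof.
move=> [n1 n2 n3] [s1 s2 s3] st lt.
have H L' M' G' T' : near_rows k L' M' -> #|[set x | d < load L' G' x]| <= w ->
    \sum_x degree T' x <= t ->
    #|[set x | m < load M' (usable G' T') x]| <= eta.
  move=> [_ nL] sw st'; pose q x := #|[set y | symof L' x y != symof M' x y]|.
  have sq : \sum_x q x <= 4 * k.
    apply: leq_trans nL; apply: eq_leq.
    under eq_bigr do rewrite /q -sum1dep_card big_mkcond /=.
    rewrite pair_big -sum1dep_card [RHS]big_mkcond.
    by apply: eq_bigr.
  have ld x : load M' (usable G' T') x <= load L' G' x + (q x + degree T' x).
    rewrite /degree; set D := #|[set pp | _]|.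
    have -> : D = #|[set pp | T' x pp.1 pp.2]| by [].
    have le2 : #|[set y | T' x y (symof M' x y)]| <= D.
      have -> : #|[set y | T' x y (symof M' x y)]| =
          #|[set (y, symof M' x y) | y in [set y | T' x y (symof M' x y)]]|.
        by rewrite card_imset // => y y' [].
      by apply/subset_leq_card/subsetP=> pp /imsetP[y]; rewrite !inE => Hy ->.
    apply: leq_trans (leq_add (leqnn _) (leq_add (leqnn _) le2)).
    apply: leq_trans (leq_add (leqnn _) (leq_card_setU _ _)).
    apply: leq_trans (leq_card_setU _ _).
    apply/subset_leq_card/subsetP=> y; rewrite !inE; apply: contraR.
    rewrite !negb_or !negbK /usable => /andP[Ha /andP[/eqP E Hf]].
    by rewrite -E Ha E.
  pose B := [set x | m.+1 - d <= q x + degree T' x].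
  have cB : (m.+1 - d) * #|B| <= 4 * k + t.
    apply: leq_trans (leq_add sq st'); rewrite -big_split /=.
    rewrite [X in _ <= X](bigID (fun x => x \in B)) /=.
    apply: leq_trans (leq_addr _ _); rewrite mulnC -sum_nat_const.
    by apply: leq_sum => x; rewrite inE.
  have : #|B| < eta.+1 - w.
    rewrite ltnNge; apply/negP=> le; move: lt; rewrite ltnNge => /negP; apply.
    by apply: leq_trans cB; rewrite leq_mul2l le orbT.
  have : #|[set x | m < load M' (usable G' T') x]| <= w + #|B|.
    apply: leq_trans (leq_add sw (leqnn _)); apply: leq_trans (leq_card_setU _ _).
    apply/subset_leq_card/subsetP=> x; rewrite !inE => Hx.
    move: (leq_trans Hx (ld x)); rewrite orbC; case: leqP => //=.
    clear; move: (load _ _ _) (q x) (degree _ _) => *; lia.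
  by clear; move: #|B| #|[set x | _]| => *; lia.
split.
- exact: H n1 s1 st.
- by apply: H n2 s2 _; rewrite (sum_degree_turn T).
- by apply: H n3 s3 _; rewrite (sum_degree_turn (turn3 T)) (sum_degree_turn T).
Qed.

(* 185 = 4 * 46 + 1: an entry of T costs at most 46 swaps of four cells each, and
   is itself not usable. *)
Theorem embed G T L (tau w d t m : nat) : structured p G -> dense tau T -> partial T ->
  sparse w L G d -> \sum_x degree T x <= t ->
  185 * t < (m.+1 - d) * (eta.+1 - w) ->
  12 * (m + 89) + 9 < #|X| -> 6 * (m + 80) + 7 * eta + 3 < #|X| ->
  2 * (tau + 6) + 4 * (m + 63) + 7 * eta + 3 < #|X| ->
  6 * tau + 7 * eta + 3 < #|X| ->
  exists M, forall x y z, T x y z -> symof M x y = z.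
Proof.
move=> sG dT pT sL st lt lt1 lt2 lt3 lt4.
pose S := [set q : X * X * X | T q.1.1 q.1.2 q.2].
have cS : #|S| <= t by rewrite -sum_degreeE.
have H (s : seq (X * X * X)) : {subset s <= S} -> size s <= t ->
    exists M, near (46 * size s) L M /\
      forall x y z, (x, y, z) \in s -> symof M x y = z.
  elim: s => [_ _|[[r c] b] s IHs sS szs].
    by exists L; split=> //; apply: near_refl.
  have [||M [nM HM]] := IHs.
  - by move=> q qs; apply: sS; rewrite inE qs orbT.
  - exact: ltnW.
  have Tb : T r c b by have := sS (r, c, b); rewrite !inE eqxx => /(_ isT).
  have spM : sparse eta M (usable G T) m.
    apply: (sparse_near nM sL st); apply: leq_ltn_trans lt.
    by move: szs; rewrite /=; clear; move: (size s) => *; lia.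
  have [M' [nM' pM' e]] := insert sG spM dT pT Tb lt1 lt2 lt3 lt4.
  exists M'; split.
    by have := near_trans nM nM'; rewrite /= mulnS addnC.
  move=> x y z; rewrite inE => /orP[/eqP[-> -> ->]//|Hs].
  have E := HM _ _ _ Hs; rewrite -E; apply: pM'; rewrite E.
  by have := sS (x, y, z); rewrite !inE Hs orbT => /(_ isT).
have [||M [_ HM]] := H (enum S).
- by move=> q; rewrite mem_enum.
- by rewrite -cardE.
by exists M => x y z Ht; apply: HM; rewrite mem_enum inE.
Qed.

End Insertion.

(** * A prolonged dihedral table *)

Section Base.

Import GRing.Theory.
Local Open Scope ring_scope.

Variables (q w : nat).
Hypothesis w_le3 : (w <= 3)%N.
Hypothesis q_gt1 : (1 < q)%N.

(** Integers modulo [2 * q]; the successor form provides the ring structure. *)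
Local Notation Z := 'I_q.*2.-2.+2.
Local Notation D := (bool * Z)%type.
Local Notation X := (D + 'I_w)%type.

Implicit Types (x y z : D) (t u : 'I_w) (i j : Z).

(** The dihedral group of order [4 * q]; the boolean marks reflections. *)
Definition dmul x y : D := (x.1 (+) y.1, if x.1 then x.2 - y.2 else x.2 + y.2).

(* A transversal of the table of dmul: the map y |-> dtrans y from columns to
   rows and the map y |-> dmul (dtrans y) y to symbols are both bijective; its
   translates by rotations are disjoint. *)
Definition dtrans y : D :=
  if (y.2 < q)%N (+) y.1 then (false, y.2) else (true, 1 - y.2).

Definition shift t y : D := ((dtrans y).1, (dtrans y).2 + inZp t).

Lemma order_Z : q.*2.-2.+2 = q.*2.
Proof. by case: q q_gt1 => [|q']. Qed.

Lemma dmul_injr x : injective (dmul x).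
Proof.
case: x => s a [e i] [e' i']; rewrite /dmul /= => -[/addbI -> {e}].
by case: s => [/addrI /oppr_inj|/addrI] ->.
Qed.

Lemma dmul_injl y : injective (fun x => dmul x y).
Proof.
move=> [e i] [e' i']; rewrite /dmul /= => -[/addIb -> {e}].
by case: e' => /addIr ->.
Qed.

Lemma dtrans_inj : injective dtrans.
Proof.
move=> [e i] [e' i']; rewrite /dtrans /=.
case: ifP => h; case: ifP => h' // /(congr1 snd) E.
  have {}E : i = i' := E.
  by move: h h'; rewrite E; case: (_ < _)%N; case: e; case: e'.
have {}E : i = i' by apply: oppr_inj; apply: addrI E.
by move: h h'; rewrite E; case: (_ < _)%N; case: e; case: e'.
Qed.

(** Distinct residues with the same double differ by [q], hence lie in different halves. *)
Lemma double_inj i j : (i < q)%N = (j < q)%N -> i + i = j + j -> i = j.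
Proof.
move=> h /(congr1 val) /= E; apply: val_inj => /=.
have R a : (a %% q.*2.-2.+2 = a %% q.*2)%N by rewrite order_Z.
have ha : (i < q.*2)%N by apply: leq_trans (ltn_ord i) _; rewrite order_Z.
have hb : (j < q.*2)%N by apply: leq_trans (ltn_ord j) _; rewrite order_Z.
rewrite !R in E.
move: (nat_of_ord i) (nat_of_ord j) ha hb h E => a b {i j} ha hb h.
have H c : (c < q.*2)%N -> ((c + c) %% q.*2 = if c < q then c + c else c + c - q.*2)%N.
  move=> hc; case: ltnP => hq; first by rewrite modn_small //; lia.
  have -> : (c + c = (c + c - q.*2) + q.*2)%N by lia.
  by rewrite modnDr modn_small; lia.
rewrite !H // -h; case: ltnP => qa; first by clear; lia.
have qb : (q <= b)%N by move: h; rewrite ltnNge qa [RHS]ltnNge => /esym /negbFE.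
by clear -qa qb; lia.
Qed.

(** Parity is well defined because the modulus is even. *)
Lemma double_odd i j : i + i <> 1 - j - j.
Proof.
move=> E; have : i + i + (j + j) = 1 by rewrite E; ring.
move=> /(congr1 (fun k : Z => odd k)) /=.
have R a : odd (a %% q.*2.-2.+2) = odd a.
  by rewrite odd_mod // order_Z odd_double.
by rewrite !(R, oddD) !addbb.
Qed.

(** With [i] the second component of [y], that of the symbol is [2 i] where [dtrans] picks a
    rotation and [1 - 2 i] otherwise, so the two cases differ in parity. Within a case the first
    component decides which half contains [i], and [double_inj] applies. *)
Lemma dmul_dtrans_inj : injective (fun y => dmul (dtrans y) y).
Proof.
move=> [e i] [e' i'] E.
have {E} := (congr1 fst E, congr1 snd E).
rewrite /dtrans /dmul /=.
case: ifP => h; case: ifP => h' /= [E1 E2].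
- have {}E2 : i = i'; last by rewrite E1 E2.
  by apply: double_inj E2; move: h h'; rewrite -E1; clear; do 2!case: (_ < _)%N; case: e.
- by case: (double_odd E2).
- by case: (double_odd (esym E2)).
- have {}E1 : e = e' by case: e e' E1 {h h' E2} => [] [].
  have {}E2 : i = i'; last by rewrite E1 E2.
  apply: double_inj.
    by move: h h'; rewrite -E1; clear; do 2!case: (_ < _)%N; case: e.
  by apply: oppr_inj; apply: (@addrI _ 1); rewrite !opprD !addrA.
Qed.

Lemma shift_inj t : injective (shift t).
Proof.
move=> y y' E; apply: dtrans_inj; have := (congr1 fst E, congr1 snd E).
rewrite /shift /=; case: (dtrans y) (dtrans y') => [a1 a2] [b1 b2] /= [-> H].
by rewrite (@addIr _ _ _ _ H).
Qed.

Lemma shift_disjoint t u y : shift t y = shift u y -> t = u.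
Proof.
move=> /(congr1 snd) /addrI /(congr1 val) /=; rewrite order_Z => H; apply: ord_inj.
have lt (v : 'I_w) : (v < q.*2)%N.
  by have := ltn_ord v; move: (nat_of_ord v) => *; lia.
by rewrite !modn_small in H.
Qed.

Lemma dmul_shift t y :
  dmul (shift t y) y = let s := dmul (dtrans y) y in (s.1, s.2 + inZp t).
Proof.
by rewrite /dmul /shift /=; case: (dtrans y).1; congr (_, _); ring.
Qed.

Lemma dmul_shift_inj t : injective (fun y => dmul (shift t y) y).
Proof.
have I (k : Z) : injective (fun a : D => (a.1, a.2 + k) : D).
  move=> [a1 a2] [b1 b2] E; have := (congr1 fst E, congr1 snd E) => /= -[-> H].
  by rewrite (@addIr _ _ _ _ H).
by move=> y y'; rewrite !dmul_shift => /I /dmul_dtrans_inj.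
Qed.

Definition addw t u : 'I_w :=
  Ordinal (ltn_pmod (t + u) (leq_ltn_trans (leq0n t) (ltn_ord t))).

Lemma addwC t u : addw t u = addw u t.
Proof. by apply: val_inj; rewrite /= addnC. Qed.

Lemma addw_inj t : injective (addw t).
Proof.
move=> u u' /(congr1 val) /= /eqP; rewrite eqn_modDl !modn_small // => /eqP.
exact: val_inj.
Qed.

(* Prolongation along w disjoint transversals, with the cyclic table on the new
   w by w corner. *)
Definition prolong (a b : X) : X :=
  match a, b with
  | inl x, inl y =>
      if [pick t | shift t y == x] is Some t then inr t else inl (dmul x y)
  | inl x, inr t => inl (dmul x (invF (@shift_inj t) x))
  | inr t, inl y => inl (dmul (shift t y) y)
  | inr t, inr u => inr (addw t u)
  end.

Lemma inl_inj : injective (@inl D 'I_w).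
Proof. by move=> x y [->]. Qed.

Lemma inr_inj : injective (@inr D 'I_w).
Proof. by move=> t u [->]. Qed.

Lemma prolong_injr a : injective (prolong a).
Proof.
case: a => [x|t] [y|u] [y'|u'] //=.
- case: pickP => [t /eqP e|n]; case: pickP => [t' /eqP e'|n'] //.
    by move=> /inr_inj E; rewrite E in e; rewrite (@shift_inj t' y y') // e e'.
  by move=> /inl_inj /dmul_injr ->.
- case: pickP => [//|n] /inl_inj /dmul_injr E.
  by have := n u'; rewrite E f_invF eqxx.
- case: pickP => [//|n] /inl_inj /dmul_injr E.
  by have := n u; rewrite -E f_invF eqxx.
- move=> /inl_inj /dmul_injr E.
  congr inr; apply: (@shift_disjoint _ _ (invF (@shift_inj u) x)).
  by rewrite {2}E !f_invF.
- by move=> /inl_inj /dmul_shift_inj ->.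
- by move=> /inr_inj /addw_inj ->.
Qed.

Lemma prolong_injl b : injective (fun a => prolong a b).
Proof.
case: b => [y|u] [x|t] [x'|t'] //=.
- case: pickP => [t /eqP e|n]; case: pickP => [t' /eqP e'|n'] //.
    by move=> /inr_inj E; rewrite -e -e' E.
  by move=> /inl_inj /dmul_injl ->.
- case: pickP => [//|n] /inl_inj /dmul_injl E.
  by have := n t'; rewrite E eqxx.
- case: pickP => [//|n] /inl_inj /dmul_injl E.
  by have := n t; rewrite E eqxx.
- by move=> /inl_inj /dmul_injl /shift_disjoint ->.
- move=> /inl_inj E; congr inl.
  rewrite -(f_invF (@shift_inj u) x) -(f_invF (@shift_inj u) x').
  congr shift; apply: (@dmul_shift_inj u).
  by rewrite !f_invF.
- by rewrite addwC (addwC t') => /inr_inj /addw_inj ->.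
Qed.

(** The whole dihedral table, including the cells that [prolong] overwrites; these merely add to the
    loads. *)
Definition table (a b c : X) : bool :=
  match a, b, c with inl x, inl y, inl z => dmul x y == z | _, _, _ => false end.

Definition parity (a : X) : bool := if a is inl x then x.1 else false.

Definition regular (a : X) : bool := if a is inl _ then true else false.

Lemma prolong_table a b :
  regular a -> regular b -> regular (prolong a b) -> table a b (prolong a b).
Proof. by case: a b => [x|t] [y|u] //=; case: pickP => //= _ _ _ _; apply: eqxx. Qed.

Lemma parity_class (s : bool) : (2 * #|[set a | parity a == s]| <= #|{: X}| + 3)%N.
Proof.
have cX : #|{: X}| = (2 * q.*2 + w)%N.
  by rewrite card_sum card_prod card_bool !card_ord order_Z.
suff H : (#|[set a | parity a == s]| <= q.*2 + w)%N.
  by rewrite cX; move: H w_le3; move: #|_| => c; lia.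
have cw : #|[set (inr t : X) | t : 'I_w]| = w.
  by rewrite card_imset ?card_ord //; apply: inr_inj.
have cz : #|[set (inl (s, i) : X) | i : Z]| = q.*2.
  have I : injective (fun i : Z => inl (s, i) : X).
    by move=> i j E; have := congr1 snd (inl_inj E).
  by rewrite (card_imset _ I) card_ord order_Z.
apply: leq_trans (leq_add (eq_leq cz) (eq_leq cw)).
apply: leq_trans (leq_card_setU _ _).
apply/subset_leq_card/subsetP=> -[[e i]|t]; rewrite !inE.
  by move=> /eqP /= <-; rewrite imset_f.
by rewrite orbC imset_f.
Qed.

Lemma dmul_eq x y x' y' : dmul x y = dmul x' y' ->
  x.1 (+) y.1 = x'.1 (+) y'.1 /\
  (if x.1 then x.2 - y.2 else x.2 + y.2) =
  (if x'.1 then x'.2 - y'.2 else x'.2 + y'.2).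
Proof. by move=> E; split; [exact: (congr1 fst E)|exact: (congr1 snd E)]. Qed.

(** With its signed variant, this lets [ring] derive one linear identity from another by comparing
    differences. *)
Lemma eq_of_sub i j i' j' : i = j -> i' - j' = i - j -> i' = j'.
Proof. by move=> -> /eqP; rewrite subrr subr_eq0 => /eqP. Qed.

Lemma eq_of_subN i j i' j' : i = j -> i' - j' = - (i - j) -> i' = j'.
Proof. by move=> -> /eqP; rewrite subrr oppr0 subr_eq0 => /eqP. Qed.

(** The quotient of two elements of opposite parity is a reflection, hence an involution;
    [dmul_close_row] holds for the same reason. *)
Lemma dmul_close_col r c r' c' : dmul r' c' = dmul r c -> c.1 != c'.1 ->
  dmul r' c = dmul r c'.
Proof.
case: r c r' c' => [[] r] [[] c] [[] r'] [[] c'] // /dmul_eq [] //= _ H _;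
  congr pair; rewrite /=.
all: by [apply: (eq_of_sub H); ring | apply: (eq_of_subN H); ring].
Qed.

Lemma dmul_close_row r c r' c' : dmul r' c' = dmul r c -> r.1 != r'.1 ->
  dmul r c' = dmul r' c.
Proof.
case: r c r' c' => [[] r] [[] c] [[] r'] [[] c'] // /dmul_eq [] //= _ H _;
  congr pair; rewrite /=.
all: by [apply: (eq_of_sub H); ring | apply: (eq_of_subN H); ring].
Qed.

Lemma structured_table : structured parity table.
Proof.
have T a b c : table a b c ->
    exists x y, [/\ a = inl x, b = inl y & c = inl (dmul x y)].
  by case: a b c => [x|?] [y|?] [z|?] //= /eqP <-; exists x, y.
split.
- by move=> a b c /T [x [y [-> -> ->]]] /=; case: x.1 y.1 => [] [].
- move=> a b c b' c' a1 a2 /T [r [y [-> -> ->]]] /T [_ [y' [[<-] -> ->]]].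
  move=> /T [r1 [_ [-> [<-] /inl_inj E1]]] /T [r2 [_ [-> [<-] /inl_inj E2]]] /= np.
  by congr inl; apply: (@dmul_injl y); rewrite /= -E1 (dmul_close_col (esym E2)).
- move=> a b c b' c' a1 a2 /T [x [y [-> -> ->]]] /T [x' [_ [-> [<-] ->]]].
  move=> /T [_ [y1 [[<-] -> /inl_inj E1]]] /T [_ [y2 [[<-] -> /inl_inj E2]]] /= np.
  congr inl; apply: (@dmul_injr x'); rewrite -E1.
  (* Within one column, symbols of opposite parity lie in rows of opposite parity. *)
  rewrite (dmul_close_row (esym E2)) //; apply: contra np.
  by rewrite /dmul /= => /eqP->.
- move=> a b c b' c' a1 a2 /T [x [y [-> -> ->]]] /T [x' [y' [-> -> /inl_inj E]]].
  move=> /T [_ [_ [[<-] [<-] ->]]] /T [_ [_ [[<-] [<-] ->]]] /= np.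
  by rewrite (dmul_close_row (esym E) np).
Qed.

(** A line of the dihedral part leaves [table] only at entries with one of the [w] added points in
    another coordinate, at most [w] for each of the two. The added lines themselves may be
    arbitrarily heavy. *)
Lemma sparse_prolong (L : lsq X) :
  (forall a b, symof L a b = prolong a b) -> sparse w L table (2 * w).
Proof.
move=> HL.
have cirr : #|[set a | ~~ regular a]| = w.
  rewrite -[RHS]card_ord -(card_imset _ inr_inj); apply: eq_card => -[x|t].
    by rewrite !inE; apply/esym/negbTE/imsetP=> -[].
  by rewrite !inE imset_f.
have H (M : lsq X) (G : ternary X) :
    (forall a b, regular a -> regular b -> regular (symof M a b) ->
       G a b (symof M a b)) ->
    (#|[set a | 2 * w < load M G a]| <= w)%N.
  move=> HG; apply: leq_trans (eq_leq cirr).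
  apply/subset_leq_card/subsetP=> a; rewrite !inE.
  apply: contraL => ra; rewrite -leqNgt.
  have -> : (2 * w = w + w)%N by rewrite mul2n addnn.
  have c2 : (#|[set b | ~~ regular (symof M a b)]| <= w)%N.
    by apply: (card_preim_leq (@symof_injr _ M a) _ (eq_leq cirr)).
  apply: leq_trans (leq_add (eq_leq cirr) c2).
  apply: leq_trans (leq_card_setU _ _); apply/subset_leq_card/subsetP=> b.
  rewrite !inE; apply: contraR; rewrite negb_or !negbK => /andP[rb rc].
  exact: HG.
have HT a b c : symof L a b = c -> regular a -> regular b -> regular c ->
    table a b c.
  by move=> <- ra rb; rewrite HL; apply: prolong_table.
split; apply: H => a b ra rb rc; rewrite /turn3.
- exact: HT.
- by apply: HT; rewrite /= ?sym_row.
- by apply: HT; rewrite /= ?sym_col.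
Qed.

End Base.

(** * The theorem *)

Import Order.TTheory GRing.Theory Num.Theory.
Local Open Scope ring_scope.

Lemma structured_square (n : nat) : (8 <= n)%N ->
  exists (X : finType) (p : X -> bool) (G : ternary X) (L : lsq X) (w : nat),
    [/\ #|X| = n, (w <= 3)%N,
        forall s : bool, (2 * #|[set u | p u == s]| <= #|X| + 3)%N,
        structured p G & sparse w L G (2 * w)].
Proof.
move=> n8; pose q := (n %/ 4)%N; pose w := (n %% 4)%N.
have w3 : (w <= 3)%N by rewrite -ltnS ltn_pmod.
have q1 : (1 < q)%N by rewrite /q; lia.
have [L HL] := lsq_of_inj (@prolong_injr q w w3 q1) (@prolong_injl q w w3 q1).
exists _, (@parity q w), (@table q w), L, w; split.
- by rewrite card_sum card_prod card_bool !card_ord order_Z // /q /w; lia.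
- exact: w3.
- exact: parity_class.
- exact: structured_table.
- exact: sparse_prolong HL.
Qed.

Lemma latin_square_exists (n : nat) : (0 < n)%N -> exists L : 'M['I_n]_n, latin_square L.
Proof.
case: n => // n _; exists (\matrix_(i, j) (i + j)); split=> k a b; rewrite !mxE.
  exact: addrI.
exact: addIr.
Qed.

(** Parameters for [embed]: a line is heavy above load [n %/ 100], at most [n %/ 40] lines of a kind
    are heavy, and [T] has at most [n %/ 13] entries on a line. A single filled cell already forces
    [n] to be at least 1325, which absorbs the additive constants. *)
Lemma thresholds (n t w : nat) : (w <= 3)%N -> (0 < t)%N ->
  (t * (100 * (1000 * 1000)) <= 57 * (n * n))%N ->
  [/\ (1325 <= n)%N, (185 * t < ((n %/ 100).+1 - 2 * w) * ((n %/ 40).+1 - w))%N,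
      (12 * (n %/ 100 + 89) + 9 < n)%N,
      (6 * (n %/ 100 + 80) + 7 * (n %/ 40) + 3 < n)%N &
      (2 * (n %/ 13 + 6) + 4 * (n %/ 100 + 63) + 7 * (n %/ 40) + 3 < n)%N /\
      (6 * (n %/ 13) + 7 * (n %/ 40) + 3 < n)%N].
Proof.
move=> w3 t0 ht.
have n1 : (1325 <= n)%N.
  by rewrite leqNgt; apply/negP=> n2; have : (n * n <= 1324 * 1324)%N;
    [apply: leq_mul|lia].
split; [by []| |lia|lia|split; lia].
have : (n - 599 <= 100 * ((n %/ 100).+1 - 6))%N by lia.
have : (n - 119 <= 40 * ((n %/ 40).+1 - 3))%N by lia.
move=> h1 h2; have h3 := leq_mul h2 h1.
apply: (@leq_trans (((n %/ 100).+1 - 6) * ((n %/ 40).+1 - 3))); last first.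
  by apply: leq_mul; lia.
move: ((n %/ 100).+1 - 6)%N ((n %/ 40).+1 - 3)%N h3 => a b h3.
(* After this shift both sides are quadratics in [k] with nonnegative coefficients, and linear
   arithmetic compares them with [k * k] as an atom. *)
have [k ek] : exists k, n = (k + 1325)%N by exists (n - 1325)%N; rewrite subnK.
have {h3} : ((k + 726) * (k + 1206) <= 4000 * (a * b))%N by move: h3; rewrite ek; lia.
move: ht; rewrite ek; have : (0 <= k * k)%N by [].
by clear; lia.
Qed.

Theorem corollary2p4p5 (n : nat) (P : 'M[option 'I_n]_n) :
  (0 < n)%N ->
  partial_latin_square P ->
  eps_dense (1 / 13) P ->
  #|filled_cells P|%:R <= 57 / 10 * 10 ^- 7 * n%:R ^+ 2 :> rat ->
  completable P.
Proof.
move=> n0 [P1 P2] [D1 D2 D3] Hf.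
(* Without filled cells [n] may be small, but any Latin square will do. *)
have [E|t0] := posnP #|filled_cells P|.
  have [L lL] := latin_square_exists n0; exists L => // i j k Pk.
  have := in_set0 (i, j); rewrite -(cards0_eq E) inE /= Pk => /negbT.
  by rewrite negbK.
set t := #|filled_cells P| in t0 Hf.
have ht : (t * (100 * (1000 * 1000)) <= 57 * (n * n))%N.
  by rewrite -(ler_nat rat) !natrM; move: Hf; lra.
have dens (S : nat) : S%:R <= 1 / 13 * n%:R :> rat -> (S <= n %/ 13)%N.
  move=> H; rewrite leq_divRL // -(ler_nat rat) natrM; lra.
(* The value [0] for [w] is a dummy: only the bound on [n] is kept, from which [structured_square]
   produces the true [w]. *)
have [n1 _ _ _ _] := @thresholds n t 0 isT t0 ht.
have [|X [p [G [L [w [cX w3 pc sG sL]]]]]] := @structured_square n.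
  exact: leq_trans n1.
have [_ c1 c2 c3 [c4 c5]] := @thresholds n t w w3 t0 ht.
have [phi [psi [phiK psiK]]] : exists (phi : 'I_n -> X) (psi : X -> 'I_n),
    cancel phi psi /\ cancel psi phi.
  exists (fun i => enum_val (cast_ord (esym cX) i)), (fun x => cast_ord cX (enum_rank x)).
  by split=> x; rewrite ?enum_valK ?cast_ordKV ?cast_ordK ?enum_rankK.
have Iphi := can_inj phiK; have Ipsi := can_inj psiK.
pose T : ternary X := fun a b c => P (psi a) (psi b) == Some (psi c).
have dT : dense (n %/ 13) T.
  split=> a; [apply: leq_trans (dens _ (D1 (psi a)))
    |apply: leq_trans (dens _ (D2 (psi a)))|apply: leq_trans (dens _ (D3 (psi a)))].
  - have I : {in [set q | T a q.1 q.2] &, injective (fun q : X * X => psi q.1)}.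
      move=> [b c] [b' c']; rewrite !inE /T /= => /eqP E /eqP E' /Ipsi eb.
      by move: E; rewrite eb E' => -[/Ipsi ->].
    rewrite /degree -(card_in_imset I); apply/subset_leq_card/subsetP=> j.
    by case/imsetP=> q; rewrite !inE /T => /eqP E ->; rewrite E.
  - have I : {in [set q | turn3 T a q.1 q.2] &, injective (fun q : X * X => psi q.2)}.
      move=> [c b] [c' b']; rewrite !inE /turn3 /T /= => /eqP E /eqP E' /Ipsi eb.
      by move: E; rewrite eb E' => -[/Ipsi ->].
    rewrite /degree -(card_in_imset I); apply/subset_leq_card/subsetP=> j.
    by case/imsetP=> q; rewrite !inE /turn3 /T => /eqP E ->; rewrite E.
  - have I : injective (fun q : X * X => (psi q.1, psi q.2)).
      by move=> [b c] [b' c'] [/Ipsi -> /Ipsi ->].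
    rewrite /degree -(card_imset _ I); apply/subset_leq_card/subsetP=> j.
    by case/imsetP=> q; rewrite !inE /turn3 /T => E ->.
have pT : partial T.
  split=> x y z v; rewrite /T => /eqP.
  - by move=> -> /eqP [/Ipsi].
  - by move=> E /eqP E'; apply: Ipsi; apply: P1 E E'.
  - by move=> E /eqP E'; apply: Ipsi; apply: P2 E E'.
have sT : (\sum_a degree T a <= t)%N.
  pose S := [set q : X * X * X | T q.1.1 q.1.2 q.2].
  rewrite sum_degreeE -/S.
  have I : {in S &, injective (fun q : X * X * X => (psi q.1.1, psi q.1.2))}.
    move=> [[a b] c] [[a' b'] c']; rewrite !inE /T /= => /eqP E /eqP E' [].
    by move=> /Ipsi ea /Ipsi eb; move: E; rewrite ea eb E' => -[/Ipsi ->].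
  rewrite -(card_in_imset I); apply/subset_leq_card/subsetP=> j.
  by case/imsetP=> q; rewrite !inE /T => /eqP E -> /=; rewrite E.
have [||||M HM] := @embed X p (n %/ 40)%N pc G T L (n %/ 13)%N w (2 * w)%N t
  (n %/ 100)%N sG dT pT sL sT c1; rewrite ?cX //.
exists (\matrix_(i, j) psi (symof M (phi i) (phi j))); last first.
  move=> i j k Pk; rewrite mxE (HM _ _ (phi k)) ?phiK // /T !phiK Pk eqxx //.
split=> k a b; rewrite !mxE => /Ipsi.
  by move/symof_injr/Iphi.
by move/(@symof_injl _ M)/Iphi.
Qed.
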